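(* Let $0\le q\le n$ and $0\le r\le m$ be integers, not both zero. (1) If $q=0$, then $\operatorname{depth}(S/J_r)=n+r-1$. (2) If $r=0$, then $\operatorname{depth}(S/I_q)=m+q-1$. (3) If $q>0$ and $r>0$, then $\operatorname{depth}(S/I_qJ_r)=q+r-1$.
   Context: Let $K$ be a field, $n,m\ge 0$ integers, and $S=K[x_1,\dots,x_n,y_1,\dots,y_m]$ the polynomial ring in $n+m$ variables with its standard grading. For $0\le k\le n$, $I_k\subseteq S$ is the ideal generated by all square-free monomials of degree $k$ in the variables $x_1,\dots,x_n$; for $0\le l\le m$, $J_l\subseteq S$ is the ideal generated by all square-free monomials of degree $l$ in the variables $y_1,\dots,y_m$. By convention $I_0=J_0=S$. Depth of a finitely generated graded $S$-module is taken with respect to the graded maximal ideal $(x_1,\dots,x_n,y_1,\dots,y_m)$. *)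

(* Defs.v *)
From HB Require Import structures.
From mathcomp Require Import all_boot all_order all_algebra.
From mathcomp Require Import generic_quotient ring_quotient.
From mathcomp Require Import freeg mpoly.
From Stdlib Require Import ClassicalEpsilon.

Set Implicit Arguments.
Unset Strict Implicit.
Unset Printing Implicit Defensive.

Import GRing.Theory.
Local Open Scope ring_scope.
Local Open Scope quotient_scope.

Section QuotientModule.
Variables (R : pzRingType) (V : lmodType R) (N : submodClosed V).

(* Quotient.quot requires a zmodClosed predicate, from which submodClosed does
   not inherit. *)
Definition submod_pred : {pred V} := N.

Fact submod_pred_zmod : zmod_closed submod_pred.
Proof.
split=> [|x y Nx Ny]; rewrite /submod_pred ?rpred0 //.
by rewrite -scaleN1r rpredD ?rpredZ.
Qed.

HB.instance Definition _ :=
  GRing.isZmodClosed.Build V submod_pred submod_pred_zmod.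

Definition quotmod : Type := Quotient.quot submod_pred.

HB.instance Definition _ := GRing.Zmodule.on quotmod.

Definition quotmod_pi : V -> quotmod := \pi_(Quotient.quot submod_pred).

Lemma quotmod_piP (u : quotmod) : exists x, u = quotmod_pi x.
Proof.
by exists (repr (u : Quotient.quot submod_pred)); rewrite /quotmod_pi reprK.
Qed.

Lemma eq_quotmod_pi x y : (quotmod_pi x == quotmod_pi y) = (x - y \in N).
Proof. exact: esym (Quotient.idealrBE submod_pred x y). Qed.

Fact quotmod_piB : {morph quotmod_pi : x y / x - y}.
Proof. exact: (raddfB \pi_(Quotient.quot submod_pred)). Qed.

HB.instance Definition _ :=
  GRing.isZmodMorphism.Build V quotmod quotmod_pi quotmod_piB.

Definition quotmod_scale (a : R) (u : quotmod) : quotmod :=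
  quotmod_pi (a *: repr (u : Quotient.quot submod_pred)).

Fact quotmod_scale_pi a x :
  quotmod_scale a (quotmod_pi x) = quotmod_pi (a *: x).
Proof.
apply/eqP; rewrite eq_quotmod_pi -scalerBr; apply: rpredZ.
by rewrite -eq_quotmod_pi /quotmod_pi reprK.
Qed.

Fact quotmod_scalerA a b u :
  quotmod_scale a (quotmod_scale b u) = quotmod_scale (a * b) u.
Proof. by case: (quotmod_piP u) => x ->; rewrite !quotmod_scale_pi scalerA. Qed.

Fact quotmod_scale1r : left_id 1 quotmod_scale.
Proof.
by move=> u; case: (quotmod_piP u) => x ->; rewrite quotmod_scale_pi scale1r.
Qed.

Fact quotmod_scalerDr : right_distributive quotmod_scale +%R.
Proof.
move=> a u v; case: (quotmod_piP u) (quotmod_piP v) => x -> [y ->].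
by rewrite -raddfD !quotmod_scale_pi scalerDr raddfD.
Qed.

Fact quotmod_scalerDl u : {morph quotmod_scale^~ u : a b / a + b}.
Proof. by move=> a b; rewrite /quotmod_scale scalerDl raddfD. Qed.

HB.instance Definition _ := GRing.Zmodule_isLmodule.Build R quotmod
  quotmod_scalerA quotmod_scale1r quotmod_scalerDr quotmod_scalerDl.

Fact quotmod_piZ a : {morph quotmod_pi : x / a *: x}.
Proof. by move=> x; rewrite -quotmod_scale_pi. Qed.

HB.instance Definition _ := GRing.isScalable.Build R V quotmod *:%R quotmod_pi
  quotmod_piZ.

End QuotientModule.

Section Ideals.
Variable R : comNzRingType.

Definition in_ideal (G : R -> Prop) (p : R) : Prop :=
  exists s : seq (R * R),
    (forall c, c \in s -> G c.2) /\ p = \sum_(c <- s) c.1 * c.2.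

(* Quotients are taken by boolean predicates, hence the classical conversion;
   the carrier is R^o so that ideals are submodules of R. *)
Definition ideal_gen (G : R -> Prop) : {pred R^o} :=
  fun p => if excluded_middle_informative (in_ideal G p) then true else false.

Lemma ideal_genP G p : reflect (in_ideal G p) (p \in ideal_gen G).
Proof.
by rewrite unfold_in /ideal_gen; case: excluded_middle_informative => h;
  constructor.
Qed.

Fact ideal_gen_submod G : GRing.subsemimod_closed (ideal_gen G).
Proof.
split; first split=> [|_ _ /ideal_genP[s [hs ->]] /ideal_genP[t [ht ->]]].
- by apply/ideal_genP; exists [::]; rewrite big_nil.
- apply/ideal_genP; exists (s ++ t); split=> [c|]; last by rewrite big_cat.
  by rewrite mem_cat => /orP[/hs|/ht].
move=> a _ /ideal_genP [s [hs ->]]; apply/ideal_genP.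
exists [seq (a * c.1, c.2) | c <- s]; split=> [_ /mapP[c cs ->]|].
  exact: (hs _ cs).
rewrite big_map /GRing.scale /= mulr_sumr.
by apply: eq_bigr => c _; rewrite mulrA.
Qed.

HB.instance Definition _ G :=
  GRing.isSubmodClosed.Build R R^o (ideal_gen G) (ideal_gen_submod G).

Definition ideal_mul (I J : {pred R^o}) : submodClosed R^o :=
  ideal_gen (fun p => exists a b, [/\ a \in I, b \in J & p = a * b]).

End Ideals.

Section Depth.
Variables (R : comNzRingType) (M : lmodType R).

(* u belongs to the submodule (s_0, s_1, ...) M. *)
Definition in_smul (s : seq R) (u : M) : Prop :=
  exists v : 'I_(size s) -> M, u = \sum_(i < size s) s`_i *: v i.

(* s_i is a nonzerodivisor on M / (s_0, ..., s_(i-1)) M, and M / (s) M <> 0. *)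
Definition regular_seq (s : seq R) : Prop :=
  (forall i, (i < size s)%N -> forall u : M,
     in_smul (take i s) (s`_i *: u) -> in_smul (take i s) u)
  /\ (exists u : M, ~ in_smul s u).

(* depth (grade) of M with respect to I: the maximal length of an M-regular
   sequence contained in I, as a relation since a maximum need not exist for
   arbitrary R and M. *)
Definition has_depth (I : {pred R^o}) (d : nat) : Prop :=
  (exists s : seq R, [/\ all (mem I) s, regular_seq s & size s = d])
  /\ (forall s : seq R, all (mem I) s -> regular_seq s -> (size s <= d)%N).

End Depth.

Section SquarefreeIdeals.
Variables (K : fieldType) (n m : nat).

(* The variables x_i and y_j are 'X_(lshift m i) and 'X_(rshift n j). *)
Definition Sxy : comNzRingType := {mpoly K[(n + m)%N]}.

Definition irrelevant_ideal : submodClosed Sxy^o :=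
  ideal_gen (fun p : Sxy => exists i : 'I_(n + m)%N, p = 'X_i).

Definition Ix (k : nat) : submodClosed Sxy^o :=
  ideal_gen (fun p : Sxy => exists A : {set 'I_n},
    #|A| = k /\ p = \prod_(i in A) 'X_(lshift m i)).

Definition Jy (l : nat) : submodClosed Sxy^o :=
  ideal_gen (fun p : Sxy => exists B : {set 'I_m},
    #|B| = l /\ p = \prod_(j in B) 'X_(rshift n j)).

End SquarefreeIdeals.

(* Main.v *)
(* Koszul cohomology bounds depth from above: if S/I has a regular sequence of
   length > d in the irrelevant ideal, its d-th Koszul cohomology vanishes, and
   an explicit nonzero class in degree d is exhibited.

   From below, for V a regular sequence of variables on S/N, the elementary
   symmetric polynomials e_(q-1), ..., e_1 of V are regular on S/(N + I_q(V)):
   split off a variable z of V and use that the colon by z is N + I_(q-1)(V')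
   while adding z gives N + (z) + I_q(V'), for V' = V - z. For I_q J_r, which is
   the intersection of I_q and J_r, the depth lemma applied to
   0 -> S/(I cap J) -> S/I x S/J -> S/(I + J) -> 0 adds one more element,
   e_q(x) + e_r(y), to the e_k(x), k < q, and the e_k(y), k < r. *)

Require Import Defs.
From HB Require Import structures.
From mathcomp Require Import all_boot all_order all_algebra.
From mathcomp Require Import freeg mpoly.
From mathcomp Require Import ring zify.
From Stdlib Require Import FunctionalExtensionality PropExtensionality.
From Stdlib Require Import ProofIrrelevance ClassicalEpsilon.

Set Implicit Arguments.
Unset Strict Implicit.
Unset Printing Implicit Defensive.

Import GRing.Theory.
Local Open Scope ring_scope.

(** * Ideals and regular sequences *)

Section RegularSequences.
Variable R : comNzRingType.

(** The Koszul class comes from a partition of the variables into d + 1 blocks. Writing X_i = w_i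
    a_k for i in block k, with a_0 = 1, makes X the combination of forms phi_k with coefficients
    a_k, where phi_k is w restricted to block k. Wedging X with phi_1, ..., phi_d then gives phi_0,
    ..., phi_d wedged together. Its values are signed sums of products of one weight from each
    block, which lie in the monomial ideal; one of them is a generator of least degree, hence
    outside m times the ideal. So the number of blocks dictates the depth. The competing regular
    sequences need not be homogeneous: the Koszul argument uses only that their elements are
    combinations of the variables. Permutability is used only for explicit sequences of homogeneous
    elements. *)

Record ideal := Ideal {
  ideal_mem :> R -> Prop;
  ideal0 : ideal_mem 0;
  idealD : forall a b, ideal_mem a -> ideal_mem b -> ideal_mem (a + b);
  imemMl : forall r a, ideal_mem a -> ideal_mem (r * a) }.

Implicit Types (N M I J : ideal) (a b z : R) (s t V : seq R).

(** Turns equivalent descriptions of an ideal into equalities, so that ideals can be rewritten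
    inside [rseq]. *)
Lemma ideal_ext N M : (forall p, N p <-> M p) -> N = M.
Proof.
case: N M => [N N0 ND NM] [M M0 MD MM] /= eqNM.
have e : N = M.
  by apply: functional_extensionality => p; apply: propositional_extensionality.
by move: e N0 ND NM => -> N0 ND NM; f_equal; apply: proof_irrelevance.
Qed.

Lemma imemMr N a r : N a -> N (a * r).
Proof. by rewrite mulrC; apply: imemMl. Qed.

Lemma idealN N a : N a -> N (- a).
Proof. by rewrite -mulN1r; apply: imemMl. Qed.

Lemma idealB N a b : N a -> N b -> N (a - b).
Proof. by move=> Na Nb; apply: idealD => //; apply: idealN. Qed.

Lemma idealBD N a b : N (a - b) -> N b -> N a.
Proof. by move=> Nab Nb; rewrite -(subrK b a); apply: idealD. Qed.

Lemma ideal_sum N (T : eqType) (r : seq T) (F : T -> R) :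
  (forall i, i \in r -> N (F i)) -> N (\sum_(i <- r) F i).
Proof.
move=> NF; rewrite big_seq; elim/big_ind: _ => //; first exact: ideal0.
exact: idealD.
Qed.

Definition zero_ideal : ideal.
Proof.
exists (fun p => p = 0) => // [a b -> ->|r a ->]; first by rewrite addr0.
by rewrite mulr0.
Defined.

Definition unit_ideal : ideal.
Proof. by exists (fun _ => True). Defined.

Definition ideal_add N M : ideal.
Proof.
exists (fun p => exists n m, [/\ N n, M m & p = n + m]).
- by exists 0, 0; split; [exact: ideal0|exact: ideal0|rewrite addr0].
- move=> _ _ [n [m [Nn Mm ->]]] [n' [m' [Nn' Mm' ->]]].
  by exists (n + n'), (m + m'); split; [exact: idealD|exact: idealD|ring].
- move=> r _ [n [m [Nn Mm ->]]].
  by exists (r * n), (r * m); split; [exact: imemMl|exact: imemMl|ring].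
Defined.

Definition ideal_cap N M : ideal.
Proof.
exists (fun p => N p /\ M p); first by split; apply: ideal0.
- by move=> a b [Na Ma] [Nb Mb]; split; apply: idealD.
- by move=> r a [Na Ma]; split; apply: imemMl.
Defined.

Definition adj N a : ideal.
Proof.
exists (fun p => exists n v, N n /\ p = n + a * v).
- by exists 0, 0; split; [exact: ideal0|rewrite mulr0 addr0].
- move=> _ _ [n [m [Nn ->]]] [n' [m' [Nn' ->]]].
  by exists (n + n'), (m + m'); split; [exact: idealD|ring].
- move=> r _ [n [m [Nn ->]]].
  by exists (r * n), (r * m); split; [exact: imemMl|ring].
Defined.

Definition colon N z : ideal.
Proof.
exists (fun p => N (z * p)); first by rewrite mulr0; apply: ideal0.
- by move=> a b; rewrite mulrDr; apply: idealD.
- by move=> r a; rewrite mulrCA; apply: imemMl.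
Defined.

Lemma sub_adj N a p : N p -> adj N a p.
Proof. by move=> Np; exists p, 0; split; rewrite ?mulr0 ?addr0. Qed.

Lemma mem_adj N a v : adj N a (a * v).
Proof. by exists 0, v; split; [exact: ideal0|rewrite add0r]. Qed.

Lemma mem_adj1 N a : adj N a a.
Proof. by rewrite -{2}[a]mulr1; apply: mem_adj. Qed.

Lemma adj_sub N M a : (forall p, N p -> M p) -> M a ->
  forall p, adj N a p -> M p.
Proof.
move=> NM Ma _ [n [v [Nn ->]]].
by apply: idealD; [exact: NM|exact: imemMr].
Qed.

Lemma adj_congr N a b : N (a - b) -> adj N a = adj N b.
Proof.
move=> Nab; apply: ideal_ext => p.
split; apply: adj_sub; try (by move=> q; apply: sub_adj).
  by apply: (@idealBD _ _ b); [exact: sub_adj|exact: mem_adj1].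
apply: (@idealBD _ _ a); last by apply: mem_adj1.
by apply: sub_adj; rewrite -opprB; apply: idealN.
Qed.

Lemma adjC N a b : adj (adj N a) b = adj (adj N b) a.
Proof.
apply: ideal_ext => p; split=> -[_ [w [[n [v [Nn ->]]] ->]]].
  by exists (n + b * w), v; split; [exists n, w|ring].
by exists (n + a * w), v; split; [exists n, w|ring].
Qed.

Lemma ideal_addC N M : ideal_add N M = ideal_add M N.
Proof.
by apply: ideal_ext => p; split=> -[n [m [? ? ->]]]; exists m, n; split=> //;
  rewrite addrC.
Qed.

Lemma ideal_add_adj N M a : ideal_add (adj N a) M = adj (ideal_add N M) a.
Proof.
apply: ideal_ext => p; split.
  move=> [_ [m [[n [v [Nn ->]]] Mm ->]]].
  by exists (n + m), v; split; [exists n, m|ring].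
move=> [_ [v [[n [m [Nn Mm ->]]] ->]]].
by exists (n + a * v), m; split; [exists n, v| |ring].
Qed.

Fixpoint rseq N s : Prop :=
  if s is a :: s' then (forall u, N (a * u) -> N u) /\ rseq (adj N a) s'
  else True.

Lemma rseq_cat N s t : rseq N (s ++ t) <-> rseq N s /\ rseq (foldl adj N s) t.
Proof.
elim: s N => [|a s IH] N /=; first by split=> [|[]].
by rewrite IH; tauto.
Qed.

Lemma sub_foldl_adj N s p : N p -> foldl adj N s p.
Proof. by elim: s N => //= a s IH N Np; apply/IH/sub_adj. Qed.

Lemma foldl_adj_sub N M s : (forall p, N p -> M p) -> {in s, forall a, M a} ->
  forall p, foldl adj N s p -> M p.
Proof.
elim: s N => //= a s IH N NM Ms p; apply: IH => [q|b bs].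
  by apply: adj_sub => //; apply: Ms; rewrite inE eqxx.
by apply: Ms; rewrite inE bs orbT.
Qed.

Lemma foldl_adjC N s a : foldl adj (adj N a) s = adj (foldl adj N s) a.
Proof. by elim: s N => //= b s IH N; rewrite adjC IH. Qed.

Lemma foldl_adj_perm N s t : perm_eq s t -> foldl adj N s = foldl adj N t.
Proof.
elim: s t N => [|a s IH] t N.
  by rewrite perm_sym => /perm_nilP ->.
move=> pst; have at_ : a \in t by rewrite -(perm_mem pst) inE eqxx.
case/splitPr: at_ pst => t1 t2 pst.
have {}pst : perm_eq s (t1 ++ t2).
  by rewrite -(perm_cons a) (perm_trans pst) // -[a :: t2]cat1s perm_catCA.
by rewrite /= (IH _ _ pst) !foldl_cat /= -foldl_adjC.
Qed.

Lemma rseq_unit s : rseq unit_ideal s.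
Proof.
elim: s => //= a s IH; split=> //.
suff -> : adj unit_ideal a = unit_ideal by [].
by apply: ideal_ext => p; split=> // _; apply: sub_adj.
Qed.

(* S/(N : z) embeds in S/N by multiplication by z, with cokernel S/(N + (z)). *)
Lemma rseq_colon N z s : rseq (colon N z) s -> rseq (adj N z) s -> rseq N s.
Proof.
elim: s N => //= a s IH N [ca rca] [za rza].
have reg u : N (a * u) -> N u.
  move=> Nau; have [n [v [Nn uE]]] := za _ (sub_adj z Nau).
  rewrite uE; apply: idealD => //; apply: ca => /=.
  rewrite (_ : z * (a * v) = a * u - a * n); first exact/idealB/imemMl.
  by rewrite uE; ring.
split=> //; apply: IH; last by rewrite adjC.
rewrite (_ : colon _ _ = adj (colon N z) a) //.
apply: ideal_ext => v; split=> /= [[n [w [Nn zvE]]]|[n [w [Nn ->]]]].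
  have : adj N z (a * w).
    exists (- n), v; split; first exact: idealN.
    by rewrite zvE; ring.
  case/za => n' [w' [Nn' wE]].
  exists (v - a * w'), w'; split; last by ring.
  rewrite (_ : z * _ = n + a * n'); first exact/idealD/imemMl.
  by rewrite mulrBr zvE wE; ring.
by exists (z * n), (z * w); split=> //; ring.
Qed.

(** As a is regular modulo N, the colon of N + (ab) by a is N + (b), while N + (ab) + (a) is N +
    (a); [rseq_colon] then reduces s to the two hypotheses. *)
Lemma rseq_mul N a b s :
  rseq N (a :: s) -> rseq N (b :: s) -> rseq N (a * b :: s).
Proof.
move=> /= [ra rsa] [rb rsb]; split=> [u|]; first by rewrite -mulrA => /ra /rb.
apply: (@rseq_colon _ a).
  rewrite (_ : colon _ _ = adj N b) //; apply: ideal_ext => u.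
  split=> /= [[n [v [Nn E]]]|[n [v [Nn ->]]]].
    exists (u - b * v), v; split; last by ring.
    by apply: ra; rewrite mulrBr E (_ : _ - _ = n) //; ring.
  by exists (a * n), v; split; [exact: imemMl|ring].
suff -> : adj (adj N (a * b)) a = adj N a by [].
apply: ideal_ext => u; split; last first.
  by case=> n [v [Nn ->]]; exists n, v; split=> //; apply: sub_adj.
apply: adj_sub; last by apply: mem_adj1.
apply: adj_sub; first by move=> p; apply: sub_adj.
exact: mem_adj.
Qed.

(* The depth lemma for 0 -> S/(I cap J) -> S/I x S/J -> S/(I + J) -> 0. *)
Lemma rseq_cap I J s g : rseq I (rcons s g) -> rseq J (rcons s g) ->
  rseq (ideal_add I J) s -> rseq (ideal_cap I J) (rcons s g).
Proof.
elim: s I J => [|a s IH] I J /=.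
  by move=> [rI _] [rJ _] _; split=> // u [/rI ? /rJ ?]; split.
move=> [rI sI] [rJ sJ] [rIJ sIJ]; split; first by move=> u [/rI ? /rJ ?]; split.
suff -> : adj (ideal_cap I J) a = ideal_cap (adj I a) (adj J a).
  apply: IH => //; rewrite ideal_add_adj ideal_addC ideal_add_adj.
  rewrite (ideal_addC J).
  suff -> : adj (adj (ideal_add I J) a) a = adj (ideal_add I J) a by [].
  apply: ideal_ext => p; split; last exact: sub_adj.
  by apply: adj_sub => //; apply: mem_adj1.
apply: ideal_ext => u; split.
  by case=> n [v [[In Jn] ->]]; split; exists n, v.
case=> -[i [v [Ii ->]]] [j [w [Jj E]]].
have : ideal_add I J (a * (v - w)).
  exists (- i), j; split; [exact: idealN|by []|].
  by rewrite mulrBr (_ : a * v = j + a * w - i); [ring|rewrite -E; ring].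
case/rIJ => i' [j' [Ii' Jj' vwE]].
exists (i + a * i'), (v - i'); split; last by ring.
split; first exact/idealD/imemMl.
rewrite (_ : i + _ = j - a * j'); first exact/idealB/imemMl.
rewrite (_ : i = j + a * w - a * v); last by rewrite -E; ring.
by rewrite (_ : v = i' + j' + w); [ring|rewrite -vwE; ring].
Qed.

End RegularSequences.
Arguments adj {R} N a.

(** * Graded permutability of regular sequences *)

Section GradedIdeals.
Variables (K : fieldType) (N : nat).
Local Notation S := {mpoly K[N]}.
Implicit Types (I J : ideal S) (a b u : S) (s t : seq S).

Lemma pihomogMl k d a u : a \is k.-homog ->
  pihomog mdeg d (a * u) = if (k <= d)%N then a * pihomog mdeg (d - k) u else 0.
Proof.
move=> ha; elim/mpolyind: u => [|c m u _ _ IH].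
  by rewrite mulr0 !pihomog0 mulr0 if_same.
rewrite mulrDr -scalerAr !raddfD /= !linearZ /= IH !pihomogX.
have hX : a * 'X_[m] \is (k + mdeg m).-homog by rewrite dhomogM ?dhomogX.
have [dE|dN] := eqVneq (k + mdeg m)%N d.
  rewrite pihomog_dE -?dE // leq_addr addKn eqxx mulrDr.
  by rewrite scalerAr.
rewrite (pihomog_ne0 dN) // scaler0 add0r; case: leqP => // kd.
case: eqP => [mE|_]; last by rewrite scaler0 add0r.
by case/eqP: dN; rewrite mE subnKC.
Qed.

Definition homog_ideal I := forall p d, I p -> I (pihomog mdeg d p).

Definition pos_homog a := exists2 k, (0 < k)%N & a \is k.-homog.

Lemma homog_ideal0 : homog_ideal (zero_ideal S).
Proof. by move=> _ d /= ->; rewrite pihomog0. Qed.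

Lemma homog_ideal_add I J :
  homog_ideal I -> homog_ideal J -> homog_ideal (ideal_add I J).
Proof.
move=> hI hJ _ d [a [b [Ia Jb ->]]].
exists (pihomog mdeg d a), (pihomog mdeg d b).
by split; [exact: hI|exact: hJ|rewrite raddfD].
Qed.

Lemma homog_adj I a : homog_ideal I -> pos_homog a -> homog_ideal (adj I a).
Proof.
move=> hI [k _ ha] _ d [b [v [Ib ->]]]; rewrite raddfD /= (pihomogMl _ _ ha).
case: ifP => _.
  by exists (pihomog mdeg d b), (pihomog mdeg (d - k) v); split; first exact: hI.
by rewrite addr0; apply/sub_adj/hI.
Qed.

Lemma homog_foldl_adj I s : homog_ideal I -> {in s, forall a, pos_homog a} ->
  homog_ideal (foldl adj I s).
Proof.
elim: s I => //= a s IH I hI hs; apply: IH => [|b bs].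
  by apply: homog_adj => //; apply: hs; rewrite inE eqxx.
by apply: hs; rewrite inE bs orbT.
Qed.

(* That b stays regular when moved first is the graded Nakayama lemma: a
   homogeneous u with b u in I lies in I + (a), and the cofactor of a has
   smaller degree. *)
Lemma rseq_swap I a b s : homog_ideal I -> pos_homog a -> pos_homog b ->
  rseq I [:: a, b & s] -> rseq I [:: b, a & s].
Proof.
move=> hI [ka ka0 ha] [kb _ hb] /= [ra [rb rs]].
have regb u : I (b * u) -> I u.
  suff main d : forall u, I (b * u) -> I (pihomog mdeg d u).
    move=> bu; rewrite [u](pihomog_partitionE (leqnn (mmeasure mdeg u))).
    by apply: ideal_sum => i _; apply: main.
  elim/ltn_ind: d => d IH {}u bu.
  have bud : I (b * pihomog mdeg d u).
    by have := hI _ (kb + d)%N bu; rewrite (pihomogMl _ _ hb) leq_addr addKn.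
  have [n [v [In udE]]] := rb _ (sub_adj a bud).
  have := congr1 (pihomog mdeg d) udE.
  rewrite pihomog_id raddfD /= (pihomogMl _ _ ha).
  case: leqP => [kad|_] E; last by rewrite E addr0; apply: hI.
  rewrite E; apply: idealD; first exact: hI.
  apply: imemMl; rewrite -pihomog_id; apply: IH.
    by rewrite ltn_subrL ka0 (leq_trans ka0).
  apply: ra; rewrite (_ : a * _ = b * pihomog mdeg d u - b * pihomog mdeg d n).
    by apply: idealB => //; apply/imemMl/hI.
  by rewrite E; ring.
split=> //; split; last by rewrite adjC.
move=> u [n [v [In auE]]].
have : adj I a (b * v).
  by exists (- n), u; split; [exact: idealN|rewrite auE; ring].
case/rb => n' [w [In' vE]].
exists (u - b * w), w; split; last by ring.
apply: ra; rewrite (_ : a * _ = n + b * n'); first exact/idealD/imemMl.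
by rewrite mulrBr auE vE; ring.
Qed.

(** Adjacent swaps bring the head of t to the front of s. Each swap happens modulo the entries
    before it, which still generate a homogeneous ideal with I. *)
Lemma rseq_perm I s t : homog_ideal I -> {in s, forall a, pos_homog a} ->
  perm_eq s t -> rseq I s -> rseq I t.
Proof.
have to_front I' a s1 s2 : homog_ideal I' ->
    {in s1 ++ a :: s2, forall b, pos_homog b} ->
    rseq I' (s1 ++ a :: s2) -> rseq I' (a :: s1 ++ s2).
  elim: s1 I' => // b s1 IH I' hI' hs [rb rs].
  have hb : pos_homog b by apply/hs/mem_head.
  apply: rseq_swap => //; first by apply: hs; rewrite mem_cat mem_head orbT.
  split=> //; apply: IH => //; first exact: homog_adj.
  by move=> c cs; apply: hs; rewrite /= inE cs orbT.
elim: t s I => [|a t IH] s I hI hs pst rs //.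
have as_ : a \in s by rewrite (perm_mem pst) inE eqxx.
case/splitPr: as_ hs pst rs => s1 s2 hs pst rs.
have [ra rs12] := to_front _ _ _ _ hI hs rs.
split=> //; apply: IH rs12.
- by apply: homog_adj => //; apply: hs; rewrite mem_cat inE eqxx orbT.
- move=> b; rewrite mem_cat => bs.
  by apply: hs; rewrite mem_cat inE orbCA bs orbT.
by rewrite -(perm_cons a) -(permPr pst) perm_sym -[a :: s2]cat1s perm_catCA.
Qed.

End GradedIdeals.

(** * Elementary symmetric polynomials and square-free ideals *)

Section SquarefreeProducts.
Variable R : comNzRingType.
Implicit Types (I J P : ideal R) (z p : R) (V s : seq R) (q : nat).

Definition ideal_scale z I : ideal R.
Proof.
exists (fun p => exists2 b, I b & p = z * b).
- by exists 0; rewrite ?mulr0 //; apply: ideal0.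
- by move=> _ _ [b Ib ->] [c Ic ->]; exists (b + c); [exact: idealD|ring].
- by move=> r _ [b Ib ->]; exists (r * b); [exact: imemMl|ring].
Defined.

(** Sorts the square-free monomials by whether the factor z occurs, a form suited to induction on V;
    [sqfree_genE] relates it to the ideal of the theorem. *)
Fixpoint sqfree_ideal V q : ideal R :=
  match V, q with
  | _, 0 => unit_ideal R
  | [::], _.+1 => zero_ideal R
  | z :: V', q'.+1 =>
    ideal_add (sqfree_ideal V' q) (ideal_scale z (sqfree_ideal V' q'))
  end.

(** The coefficient of T^q in the product of the 1 + v T, for v in V. *)
Fixpoint esym_pol V q : R :=
  match V, q with
  | _, 0 => 1
  | [::], _.+1 => 0
  | z :: V', q'.+1 => esym_pol V' q + z * esym_pol V' q'
  end.

(** The order is descending so that the top coefficient, the one that becomes a product in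
    [rseq_symmetric], comes first. *)
Fixpoint down (a : nat -> R) q : seq R :=
  if q is q'.+1 then a q :: down a q' else [::].

Lemma size_down a q : size (down a q) = q.
Proof. by elim: q => //= q ->. Qed.

Lemma mem_down a q x : x \in down a q -> exists2 k, (0 < k)%N & x = a k.
Proof.
elim: q => //= q IH; rewrite inE => /orP[/eqP ->|/IH //].
by exists q.+1.
Qed.

Lemma sqfree_ideal0 V : sqfree_ideal V 0 = unit_ideal R.
Proof. by case: V. Qed.

Lemma esym_pol0 V : esym_pol V 0 = 1.
Proof. by case: V. Qed.

Lemma sqfree_ideal_scale z V q p :
  sqfree_ideal V q p -> sqfree_ideal (z :: V) q.+1 (z * p).
Proof.
move=> Vp; exists 0, (z * p); split; [exact: ideal0|by exists p|].
by rewrite add0r.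
Qed.

Lemma sqfree_ideal_cons z V q p :
  sqfree_ideal V q p -> sqfree_ideal (z :: V) q p.
Proof.
case: q => // q Vp; exists p, 0; split; rewrite ?addr0 //; exact: ideal0.
Qed.

Lemma sqfree_idealW V q p : sqfree_ideal V q.+1 p -> sqfree_ideal V q p.
Proof.
elim: V q p => [|z V IH] [|q] p //= [a [_ [Va [b Vb ->] ->]]].
exists a, (z * b); split=> //; first exact: IH.
by exists b => //; apply: IH.
Qed.

Lemma esym_pol_sqfree V q : sqfree_ideal V q (esym_pol V q).
Proof.
elim: V q => [|z V IH] [|q] //=; exists (esym_pol V q.+1), (z * esym_pol V q).
by split=> //; exists (esym_pol V q).
Qed.

Lemma sqfree_ideal_gt V q : (size V < q)%N -> sqfree_ideal V q = zero_ideal R.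
Proof.
elim: V q => [|z V IH] [|q] //= ltq; rewrite !IH //; last exact: ltnW.
apply: ideal_ext => p; split=> [[_ [_ [-> [_ -> ->] ->]]]|->] /=.
  by rewrite mulr0 addr0.
by exists 0, 0; split=> //; [exists 0; rewrite ?mulr0|rewrite addr0].
Qed.

Lemma ideal_add0 I : ideal_add I (zero_ideal R) = I.
Proof.
apply: ideal_ext => p; split=> [[n [_ [In -> ->]]]|Ip]; first by rewrite addr0.
by exists p, 0; rewrite addr0.
Qed.

Lemma ideal_add_unit I : ideal_add I (unit_ideal R) = unit_ideal R.
Proof.
apply: ideal_ext => p; split=> // _.
by exists 0, p; split; rewrite ?add0r //; apply: ideal0.
Qed.

Lemma rseq_cons_congr I a b s : I (a - b) -> rseq I (a :: s) -> rseq I (b :: s).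
Proof.
move=> Iab [ra rs]; split; last by rewrite -(adj_congr Iab).
move=> u Ibu; apply: ra; apply: (idealBD (b := b * u)) => //.
by rewrite -mulrBl; apply: imemMr.
Qed.

Lemma rseq_down_congr I (a b : nat -> R) q :
  (forall k, (0 < k)%N -> I (a k - b k)) -> rseq I (down a q) ->
  rseq I (down b q).
Proof.
elim: q I => // q IH I Iab rs; apply: (rseq_cons_congr (a := a q.+1)).
  exact: Iab.
case: rs => ra rs; split=> //; apply: IH rs => k k0.
by apply: sub_adj; apply: Iab.
Qed.

(** If z u = n + a + z b, with a in I_(q+1)(V) and b in I_q(V), then z (u - b) lies in I + I_q(V),
    and z can be cancelled. *)
Lemma colon_sqfree I z V q :
  (forall u, ideal_add I (sqfree_ideal V q) (z * u) ->
     ideal_add I (sqfree_ideal V q) u) ->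
  colon (ideal_add I (sqfree_ideal (z :: V) q.+1)) z =
  ideal_add I (sqfree_ideal V q).
Proof.
move=> rz; apply: ideal_ext => u; split=> /=.
  move=> [n [_ [In [a [_ [Va [b Vb ->] ->]]] E]]].
  apply: (@idealBD _ (ideal_add _ _) _ b); last first.
    by exists 0, b; rewrite add0r; split=> //; apply: ideal0.
  apply: rz; exists n, a; split=> //; first exact: sqfree_idealW.
  by rewrite mulrBr E; ring.
move=> [n [a [In Va ->]]]; exists (z * n), (z * a); split.
- exact: imemMl.
- exact: sqfree_ideal_scale.
- by ring.
Qed.

Lemma adj_sqfree I z V q :
  adj (ideal_add I (sqfree_ideal (z :: V) q)) z =
  ideal_add (adj I z) (sqfree_ideal V q).
Proof.
rewrite ideal_add_adj; apply: ideal_ext => p; split; apply: adj_sub;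
    try exact: mem_adj1.
  case: q => [|q] x; first by rewrite !sqfree_ideal0; apply: sub_adj.
  move=> [n [_ [In [a [_ [Va [b Vb ->] ->]]] ->]]].
  by exists (n + a), b; split; [exists n, a|ring].
move=> x [n [a [In Va ->]]]; apply: sub_adj; exists n, a; split=> //.
exact: sqfree_ideal_cons.
Qed.

End SquarefreeProducts.

(** * Regularity of the elementary symmetric polynomials *)

Section SymmetricSequences.
Variables (K : fieldType) (N : nat).
Local Notation S := {mpoly K[N]}.
Implicit Types (I J : ideal S) (z : S) (s V : seq S).

Lemma homog_sqfree V q :
  {in V, forall v, v \is 1.-homog} -> homog_ideal (sqfree_ideal V q).
Proof.
elim: V q => [|z V IH] [|q] hV //=; first exact: homog_ideal0.
have hV' : {in V, forall v, v \is 1.-homog}.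
  by move=> v vV; apply: hV; rewrite inE vV orbT.
apply: homog_ideal_add; first exact: IH.
move=> _ d [b Vb ->]; rewrite (pihomogMl (k := 1)) ?hV ?mem_head //.
case: ifP => _; last exact: ideal0.
by exists (pihomog mdeg (d - 1) b) => //; apply: IH.
Qed.

Lemma esym_pol_homog V q : {in V, forall v, v \is 1.-homog} ->
  esym_pol V q \is q.-homog.
Proof.
elim: V q => [|z V IH] [|q] hV //=; try exact: dhomog1; first exact: dhomog0.
have hV' : {in V, forall v, v \is 1.-homog}.
  by move=> v vV; apply: hV; rewrite inE vV orbT.
by rewrite rpredD ?IH // -[q.+1]add1n dhomogM ?IH ?hV ?mem_head.
Qed.

(* The c_k are the coefficients of (1 + a_1 T + ... + a_p T^p)(1 + z T); modulo
   z they reduce to the a_k, and modulo a_p to the same product one degree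
   lower. *)
Lemma rseq_symmetric I z (a : nat -> S) p :
    homog_ideal I -> pos_homog z -> a 0 = 1 ->
    (forall k, (0 < k)%N -> pos_homog (a k)) -> rseq I (z :: down a p) ->
  rseq I (z * a p :: down (fun k => a k + z * a k.-1) p).
Proof.
move=> hI hz a0 ha; elim: p I hI => [|p IH] I hI; first by rewrite a0 mulr1.
move=> rza; apply: rseq_mul.
  case: rza => rz ra; split=> //.
    apply: (@rseq_down_congr _ _ a _ p.+1) ra => k k0.
  rewrite opprD addrA subrr add0r -mulrN; exact: mem_adj.
have [ra raz] : rseq I [:: a p.+1, z & down a p].
  by apply: rseq_swap rza => //; apply: ha.
split=> //; apply: (@rseq_cons_congr _ _ (z * a p)); last first.
  by apply: IH => //; apply: homog_adj => //; apply: ha.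
rewrite opprD addrCA subrr addr0.
by apply: idealN; apply: mem_adj1.
Qed.

(** The prefix s receives the variables split off from V during the induction. The bound includes q
    = [size V], where the square-free ideal is zero and all of e_1, ..., e_q are regular modulo
    I. *)
Lemma rseq_sqfree I s V q :
    homog_ideal I -> {in s, forall a, pos_homog a} ->
    {in V, forall v, v \is 1.-homog} -> (q <= size V)%N -> rseq I (s ++ V) ->
  rseq (ideal_add I (sqfree_ideal V q.+1)) (s ++ down (esym_pol V) q).
Proof.
elim: V q I s => [|z V IH] q I s hI hs hV leq rs.
  by case: q leq => // _; rewrite ideal_add0.
have hz1 : z \is 1.-homog by apply: hV; rewrite mem_head.
have hz : pos_homog z by exists 1%N.
have hV' : {in V, forall v, v \is 1.-homog}.
  by move=> v vV; apply: hV; rewrite inE vV orbT.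
have hsV (t : seq S) :
    {subset t <= s ++ z :: V} -> {in t, forall a, pos_homog a}.
  move=> st a /st; rewrite mem_cat => /orP[/hs //|aV].
  by exists 1%N => //; apply: hV.
have rsz : rseq I ((s ++ [:: z]) ++ V) by rewrite -catA.
have rz u : ideal_add I (sqfree_ideal V q) (z * u) ->
    ideal_add I (sqfree_ideal V q) u.
  case: q leq => [|q] leq; first by rewrite sqfree_ideal0 ideal_add_unit.
  suff : rseq (ideal_add I (sqfree_ideal V q.+1))
      ([:: z] ++ down (esym_pol V) q).
    by case=> rz _; apply: rz.
  apply: IH => //; first by move=> a; rewrite inE => /eqP ->.
  have : rseq I ((z :: V) ++ s).
    apply: rseq_perm rs => //; last by rewrite perm_catC.
    exact: (hsV (s ++ z :: V)).
  by case/rseq_cat.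
(* This is the colon side. With z appended to the prefix, [rseq_symmetric] yields z e_(q-1)(V) as
   leading element, which agrees with e_q of z :: V modulo I_q(V). *)
have main : rseq (ideal_add I (sqfree_ideal V q))
    (s ++ down (esym_pol (z :: V)) q).
  case: q leq rz => [|q] leq _.
    by rewrite sqfree_ideal0 ideal_add_unit; apply: rseq_unit.
  have : rseq (ideal_add I (sqfree_ideal V q.+1))
      ((s ++ [:: z]) ++ down (esym_pol V) q).
    apply: IH => //; apply: hsV => a; rewrite !mem_cat !inE.
    by case/orP=> -> //; rewrite orbT.
  rewrite -catA => /rseq_cat[rQs rQz]; apply/rseq_cat; split=> //.
  apply: (@rseq_cons_congr _ _ (z * esym_pol V q)).
    rewrite opprD addrCA subrr addr0; apply/idealN/sub_foldl_adj.
    exists 0, (esym_pol V q.+1); split; [exact: ideal0|exact: esym_pol_sqfree|].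
    by rewrite add0r.
  have hQ : homog_ideal (ideal_add I (sqfree_ideal V q.+1)).
    by apply: homog_ideal_add => //; apply: homog_sqfree.
  have [] := rseq_symmetric (homog_foldl_adj hQ hs) hz (esym_pol0 V) _ rQz.
    by move=> [|k] // _; exists k.+1 => //; apply: esym_pol_homog.
  move=> r1 r2; split=> //; apply: rseq_down_congr r2 => -[|k] // _.
  by rewrite (_ : _ - _ = 0); [exact: ideal0|rewrite /= subrr].
(* In the extreme case q = [size V] + 1 both square-free ideals are zero, and the colon side is
   already the claim. *)
have [ltq|geq] := ltnP q (size V).+1; last first.
  by move: main; rewrite !sqfree_ideal_gt //= ltnS.
apply: (@rseq_colon _ _ z); first by rewrite colon_sqfree.
rewrite adj_sqfree.
have : rseq (adj I z) (s ++ V).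
  have [] // : rseq I (z :: (s ++ V)).
  by apply: rseq_perm rs => //; [exact: hsV|rewrite -[z :: V]cat1s perm_catCA].
move/(IH q _ _ (homog_adj hI hz) hs hV' ltq) => /rseq_cat[rzs rzV].
(* Modulo z, each e_k of z :: V reduces to e_k of V. *)
apply/rseq_cat; split=> //; apply: rseq_down_congr rzV => -[|k] // _.
rewrite /= opprD addrA subrr add0r; apply/idealN/sub_foldl_adj.
by exists (z * esym_pol V k), 0; split; rewrite ?addr0 //;
  [exact: mem_adj|exact: ideal0].
Qed.

(** With P the product of I_q(V) and I, this says that the intersection is the product. P is left
    arbitrary because the induction on V replaces it by another ideal, namely a colon by z or a sum
    that absorbs the multiples of z. *)
Lemma sqfree_cap I V q (P : ideal S) p :
    homog_ideal I -> {in V, forall v, v \is 1.-homog} -> rseq I V ->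
    (forall a b, sqfree_ideal V q a -> I b -> P (a * b)) ->
  sqfree_ideal V q p -> I p -> P p.
Proof.
elim: V q I P p => [|z V IH] q I P p hI hV rV PV.
  case: q PV => [|q] PV; last by move=> /= -> _; apply: ideal0.
  by move=> _ Ip; rewrite -[p]mul1r; apply: PV.
case: q PV => [|q] PV; first by move=> _ Ip; rewrite -[p]mul1r; apply: PV.
have hz1 : z \is 1.-homog by apply: hV; rewrite mem_head.
have hz : pos_homog z by exists 1%N.
have hV' : {in V, forall v, v \is 1.-homog}.
  by move=> v vV; apply: hV; rewrite inE vV orbT.
have rV' : rseq I V.
  have : rseq I (V ++ [:: z]).
    apply: rseq_perm rV => //; first by move=> v /hV; exists 1%N.
    by rewrite perm_sym perm_catC.
  by case/rseq_cat.
case: rV => rz rzV [a [_ [Va [b Vb ->] ->]]] Ip.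
(* Since p = a + z b lies in I, a lies in I + (z), on whose quotient V is still regular. The
   resulting a = x + z b' leaves p - x = z (b' + b) in I, so b' + b is in I. *)
have [x [_ [[Px Ix] [b' Vb' ->] aE]]] :
    ideal_add (ideal_cap P I) (ideal_scale z (sqfree_ideal V q.+1)) a.
  apply: (IH q.+1 (adj I z)) => //; first exact: homog_adj.
    move=> c _ Vc [n [v [In ->]]]; exists (c * n), (z * (c * v)).
    split; last by ring.
      by split; [apply: PV => //; apply: sqfree_ideal_cons|apply: imemMl].
    by exists (c * v) => //; apply: imemMr.
  exists (a + z * b), (- b); split=> //; by ring.
rewrite aE -addrA -mulrDr; apply: idealD => //.
apply: (IH q I (colon P z)) => //=.
- move=> c d Vc Id; rewrite mulrA; apply: PV => //.
  exact: sqfree_ideal_scale.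
- by apply: idealD => //; apply: sqfree_idealW.
apply: rz; rewrite (_ : z * _ = a + z * b - x); last by rewrite aE; ring.
exact: idealB.
Qed.

End SymmetricSequences.

(** * Regular sequences on quotient modules *)

Section Variables.
Variables (K : fieldType) (N : nat).
Local Notation S := {mpoly K[N]}.
Implicit Types (I J : ideal S) (s t : seq 'I_N).

Definition kill_vars t : S -> S :=
  mmap (@mpolyC N K) (fun i => if i \in t then 0 else 'X_i).

Local Notation var_ideal t :=
  (foldl adj (zero_ideal S) [seq 'X_i | i <- t]).

Lemma kill_varsE t p : var_ideal t (p - kill_vars t p).
Proof.
have varI i : i \in t -> var_ideal t 'X_i.
  elim: t (zero_ideal S) => //= j t IH I; rewrite inE.
  case/orP=> [/eqP <-|/IH //]; exact/sub_foldl_adj/mem_adj1.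
elim/mpolyind: p => [|c m p _ _ IH].
  by rewrite /kill_vars mmap0 subrr; apply: ideal0.
rewrite /kill_vars mmapD mmapZ mmapX opprD addrACA; apply: idealD => //.
rewrite -mul_mpolyC -mulrBr; apply: imemMl.
rewrite mpolyXE_id /mmap1; elim/big_ind2: _ => [|a b c' d Iab Icd|i _].
- by rewrite subrr; apply: ideal0.
- rewrite (_ : b * d - a * c' = (b - a) * c' + b * (d - c')); last first.
    by rewrite mulrBl mulrBr [RHS]addrC addrA subrK.
  by apply: idealD; [exact: imemMr|exact: imemMl].
case: ifP => it; last by rewrite subrr; apply: ideal0.
case: (m i) => [|k]; first by rewrite !expr0 subrr; apply: ideal0.
by rewrite exprS exprS mul0r subr0; apply/imemMr/varI.
Qed.

Lemma var_ideal_kill t p : var_ideal t p -> kill_vars t p = 0.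
Proof.
suff main I : (forall p, I p -> kill_vars t p = 0) -> forall s,
    {subset s <= t} -> forall p,
    foldl adj I [seq 'X_i | i <- s] p -> kill_vars t p = 0.
  by apply: (main (zero_ideal S)) => // _ ->; rewrite /kill_vars mmap0.
move=> It s; elim: s I It => //= i s IH I It st; apply: IH.
  move=> _ [n [v [In ->]]].
  rewrite /kill_vars rmorphD rmorphM /= [mmap _ _ n]It // mmapX mmap1U.
  by rewrite st ?mem_head // mul0r addr0.
by move=> j js; apply: st; rewrite inE js orbT.
Qed.

(** Setting the variables of t to zero has kernel [var_ideal t] and values in a domain, where a
    variable outside t stays nonzero. *)
Lemma rseq_vars s : uniq s -> rseq (zero_ideal S) [seq 'X_i | i <- s].
Proof.
suff main t : uniq (t ++ s) -> rseq (var_ideal t) [seq 'X_i | i <- s].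
  by apply: (main [::]).
elim: s t => //= i s IH t us; split; last first.
  by have := IH (rcons t i); rewrite cat_rcons map_rcons -cats1 foldl_cat;
    apply.
move=> u /var_ideal_kill; rewrite /kill_vars rmorphM /= mmapX mmap1U.
have /negPf -> : i \notin t.
  by move: us; rewrite cat_uniq /= negb_or => /and3P[_ /andP[]].
move/eqP; rewrite mulf_eq0 => /orP[/eqP/(congr1 (mcoeff U_(i)))|/eqP u0].
  by rewrite mcoeffX eqxx mcoeff0 => /eqP; rewrite oner_eq0.
by rewrite -[u]subr0 -u0; apply: kill_varsE.
Qed.

End Variables.

Section QuotientRegularity.
Variable R : comNzRingType.

Definition ideal_of (J : submodClosed R^o) : ideal R.
Proof.
refine (@Ideal R (fun p : R => (p : R^o) \in J) _ _ _); first exact: rpred0.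
- by move=> a b; apply: rpredD.
- by move=> r a; apply: rpredZ.
Defined.

Variable J : submodClosed R^o.

Lemma foldl_adjP (I : ideal R) (s : seq R) (u : R) :
  foldl adj I s u <->
  exists w : nat -> R, I (u - \sum_(i < size s) s`_i * w i).
Proof.
elim/last_ind: s u => [|s a IH] u.
  split=> [Iu|[w]]; last by rewrite big_ord0 subr0.
  by exists (fun=> 0); rewrite big_ord0 subr0.
have sumE (w : nat -> R) : \sum_(i < size (rcons s a)) (rcons s a)`_i * w i =
    \sum_(i < size s) s`_i * w i + a * w (size s).
  rewrite size_rcons big_ord_recr /= nth_rcons ltnn eqxx; congr (_ + _).
  by apply: eq_bigr => i _; rewrite nth_rcons ltn_ord.
rewrite -cats1 foldl_cat cats1 /=; split=> [[n [v [/IH [w Iw] ->]]]|[w]].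
  pose w' i := if (i < size s)%N then w i else v; exists w'.
  rewrite sumE /w' ltnn (eq_bigr (fun i : 'I_(size s) => s`_i * w i)).
    by rewrite opprD addrACA subrr addr0.
  by move=> i _; rewrite ltn_ord.
rewrite sumE => Iw; exists (u - a * w (size s)), (w (size s)).
split; last by rewrite subrK.
by apply/IH; exists w; rewrite addrAC -addrA -opprD.
Qed.

Lemma in_smulP (s : seq R) (u : R) :
  in_smul s (quotmod_pi J u) <-> foldl adj (ideal_of J) s u.
Proof.
have piE (w : nat -> R) : \sum_(i < size s) s`_i *: quotmod_pi J (w i) =
    quotmod_pi J (\sum_(i < size s) s`_i * w i).
  by rewrite raddf_sum; apply: eq_bigr => i _; rewrite -linearZ.
rewrite foldl_adjP; split=> [[v uE]|[w Jw]]; last first.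
  by exists (fun i => quotmod_pi J (w i)); apply/eqP; rewrite piE eq_quotmod_pi.
have [w wE] : exists w : 'I_(size s) -> R, forall i, v i = quotmod_pi J (w i).
  have vP i : exists x : R, v i = quotmod_pi J x by exact: (quotmod_piP (v i)).
  exact: (fin_all_exists vP).
pose w' k := oapp w 0 (insub k); exists w'.
have /eqP : quotmod_pi J u = quotmod_pi J (\sum_(i < size s) s`_i * w' i).
  by rewrite -piE uE; apply: eq_bigr => i _; rewrite /w' valK /= wE.
by rewrite eq_quotmod_pi.
Qed.

Lemma regular_seqP (s : seq R) :
  regular_seq (quotmod J) s <->
  rseq (ideal_of J) s /\ exists u, ~ foldl adj (ideal_of J) s u.
Proof.
have rseqE I (t : seq R) : rseq I t <-> forall i, (i < size t)%N -> forall u,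
    foldl adj I (take i t) (t`_i * u) -> foldl adj I (take i t) u.
  elim: t I => [|a t IH] I //=; rewrite IH; split=> [[ra rt] [|i] //|rat].
    by move=> lti; apply: rt.
  by split=> [|i lti]; [apply: (rat 0)|apply: (rat i.+1)].
rewrite rseqE; split=> -[rs [u nu]]; split.
- move=> i /rs ri v; rewrite -!in_smulP => sv; apply: ri.
  by move: sv; rewrite -[s`_i * v]/(s`_i *: (v : R^o)) linearZ.
- by case: (quotmod_piP u) nu => v ->; rewrite in_smulP => ?; exists v.
- move=> i /rs ri v; case: (quotmod_piP v) => {}v ->.
  by rewrite -linearZ !in_smulP; apply: ri.
- by exists (quotmod_pi J u); rewrite in_smulP.
Qed.

End QuotientRegularity.

(** * Koszul cohomology *)

Section KoszulCochains.
Variables (R : comNzRingType) (T : finType).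
Implicit Types (phi psi : T -> R) (c b : seq T -> R) (s t : seq T).
Implicit Types (I J L : ideal R).

(* Cochains are functions on all tuples of indices, not only on increasing ones:
   no signs of permutations arise, and contraction with an index, the homotopy
   showing that each X i acts as zero on cohomology, is c |-> c (i :: _). The
   Koszul differential is wedge X, for X : T -> R the family of variables. *)
Fixpoint wedge phi c s : R :=
  if s is i :: s' then phi i * c s' - wedge phi (fun t => c (i :: t)) s' else 0.

Lemma wedge_lin phi c c' a s :
  wedge phi (fun t => a * c t + c' t) s = a * wedge phi c s + wedge phi c' s.
Proof.
elim: s c c' => [|i s IH] c c' /=; first by rewrite mulr0 addr0.
by rewrite (IH (fun t => c (i :: t))); ring.
Qed.

Lemma wedge_sum (F : finType) phi (g : F -> R) (c : F -> seq T -> R) s :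
  wedge phi (fun t => \sum_k g k * c k t) s = \sum_k g k * wedge phi (c k) s.
Proof.
elim: s c => [|i s IH] c /=; first by rewrite big1 // => k _; rewrite mulr0.
rewrite (IH (fun k t => c k (i :: t))) mulr_sumr -sumrB.
by apply: eq_bigr => k _; ring.
Qed.

Lemma wedge_suml (F : finType) (g : F -> R) (phi : F -> T -> R) c s :
  wedge (fun i => \sum_k g k * phi k i) c s = \sum_k g k * wedge (phi k) c s.
Proof.
elim: s c => [|i s IH] c /=; first by rewrite big1 // => k _; rewrite mulr0.
rewrite IH mulr_suml -sumrB.
by apply: eq_bigr => k _; ring.
Qed.

Lemma wedge_ideal I a phi c s :
  (forall i t, (size t).+1 = size s -> I (a * (phi i * c t))) ->
  I (a * wedge phi c s).
Proof.
elim: s c => [|i s IH] c Ic /=; first by rewrite mulr0; apply: ideal0.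
rewrite mulrBr; apply: idealB; first exact: Ic.
by apply: IH => j t st; apply: Ic; rewrite /= st.
Qed.

Lemma eq_wedge phi c c' s :
  (forall t, (size t).+1 = size s -> c t = c' t) ->
  wedge phi c s = wedge phi c' s.
Proof.
elim: s c c' => //= i s IH c c' cc'; rewrite cc' //.
by congr (_ - _); apply: IH => t st; apply: cc'; rewrite /= st.
Qed.

Lemma eq_wedgel phi psi c s : phi =1 psi -> wedge phi c s = wedge psi c s.
Proof. by move=> e; elim: s c => //= i s IH c; rewrite e IH. Qed.

Lemma wedge0 phi c s : {in s, forall i, phi i = 0} -> wedge phi c s = 0.
Proof.
elim: s c => //= i s IH c phi0; rewrite phi0 ?mem_head // mul0r IH ?subr0 //.
by move=> j js; apply: phi0; rewrite inE js orbT.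
Qed.

Lemma wedge_cst0 phi s : wedge phi (fun=> 0) s = 0.
Proof. by elim: s => //= i s ->; rewrite mulr0 subr0. Qed.

(** Contraction with an index is an antiderivation; [wedge] by phi is then applied linearly. *)
Lemma wedge_cons phi psi c i s : wedge phi (fun t => wedge psi c (i :: t)) s =
  psi i * wedge phi c s - wedge phi (wedge psi (fun t => c (i :: t))) s.
Proof.
pose c' t := -1 * wedge psi (fun t => c (i :: t)) t + (psi i * c t + 0).
rewrite (_ : wedge phi _ s = wedge phi c' s); last first.
  by apply: eq_wedge => t _; rewrite /c' /=; ring.
by rewrite !wedge_lin wedge_cst0; ring.
Qed.

Lemma wedgeC phi psi c s :
  wedge phi (wedge psi c) s = - wedge psi (wedge phi c) s.
Proof.
elim: s c => [|i s IH] c; first by rewrite /= oppr0.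
have E (f g : T -> R) : wedge f (wedge g c) (i :: s) = f i * wedge g c s -
    (g i * wedge f c s - wedge f (wedge g (fun t => c (i :: t))) s).
  by rewrite -wedge_cons.
by rewrite !E (IH (fun t => c (i :: t))); ring.
Qed.

(** Anticommutation gives only that twice this value is zero, which says nothing in characteristic
    2; hence a separate induction. *)
Lemma wedge_sq phi c s : wedge phi (wedge phi c) s = 0.
Proof.
elim: s c => // i s IH c.
have -> : wedge phi (wedge phi c) (i :: s) = phi i * wedge phi c s -
    (phi i * wedge phi c s - wedge phi (wedge phi (fun t => c (i :: t))) s).
  by rewrite -wedge_cons.
by rewrite IH subr0 subrr.
Qed.

Variable X : T -> R.

(* Vanishing of the d-th Koszul cohomology of R/I. *)
Definition acyclic_at I d := forall c,
  (forall s, size s = d.+1 -> I (wedge X c s)) ->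
  exists b, forall s, size s = d -> I (c s - wedge X b s).

(** Contracting the cocycle c with the coefficients g of f gives h with X wedge h = f c modulo I. So
    h is a cocycle modulo I + (f), one degree lower; by induction h = X wedge b + f v modulo I, and
    cancelling f in f c = f (X wedge v) makes c a coboundary. *)
Lemma rseq_acyclic I (fs : seq R) d : rseq I fs ->
    {in fs, forall f, exists g : T -> R, f = \sum_i g i * X i} ->
  (d < size fs)%N -> acyclic_at I d.
Proof.
elim: fs I d => // f fs IH I d [rf rfs] fsX ltd c Ic.
have [g fE] := fsX f (mem_head f fs).
pose h s := \sum_i g i * c (i :: s).
have homotopy s : size s = d -> I (f * c s - wedge X h s).
  move=> ss; rewrite wedge_sum fE mulr_suml -sumrB; apply: ideal_sum => i _.
  rewrite -mulrA -mulrBr; apply: imemMl.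
  by apply: (Ic (i :: s)); rewrite /= ss.
case: d ltd Ic homotopy => [|d] ltd Ic homotopy.
  exists (fun=> 0) => -[] // _; rewrite subr0; apply: rf.
  by have := homotopy [::] erefl; rewrite subr0.
have [b hb] : exists b, forall s, size s = d -> adj I f (h s - wedge X b s).
  apply: (IH (adj I f) d rfs _ _ h) => //.
    by move=> x xfs; apply: fsX; rewrite inE xfs orbT.
  move=> s ss; apply: (idealBD (b := f * c s)); last exact: mem_adj.
  by rewrite -opprB; apply/idealN/sub_adj/homotopy.
(* Cochains are defined on tuples of every length, so the cofactor v is constrained only at length
   d. *)
have ex_v s : exists v, size s = d -> I (h s - wedge X b s - f * v).
  case: (eqVneq (size s) d) => [/hb[n [v [In ->]]]|ns].
    by exists v => _; rewrite addrK.
  by exists 0 => ss; rewrite ss eqxx in ns.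
pose v s := proj1_sig (constructive_indefinite_description _ (ex_v s)).
have vE s : size s = d -> I (h s - wedge X b s - f * v s).
  exact: proj2_sig (constructive_indefinite_description _ (ex_v s)).
exists v => s ss; apply: rf; rewrite mulrBr.
have : I (1 * wedge X (fun t => h t - wedge X b t - f * v t) s).
  apply: wedge_ideal => i t; rewrite ss => -[st].
  by apply/imemMl/imemMl/vE.
rewrite mul1r; set W := wedge X _ s.
have -> : W = wedge X h s - f * wedge X v s.
  transitivity (wedge X (fun t => (- f) * v t + (- 1 * wedge X b t + h t)) s).
    by apply: eq_wedge => t _; ring.
  by rewrite !wedge_lin wedge_sq; ring.
move=> IW; apply: (idealBD (b := wedge X h s - f * wedge X v s)) => //.
rewrite (_ : _ - _ = f * c s - wedge X h s); first exact: homotopy.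
by ring.
Qed.

(** * An explicit nonzero Koszul class *)

Section NonvanishingClass.
Variables (beta : T -> nat) (w : T -> R) (a : nat -> R).

Definition block k : T -> R := fun i => if beta i == k then w i else 0.

Definition blocks (ks : seq nat) : seq T -> R :=
  foldr (fun k => wedge (block k)) (fun=> 1) ks.

Lemma wedge_blocks0 k ks s : k \in ks -> wedge (block k) (blocks ks) s = 0.
Proof.
elim: ks s => //= l ks IH s; rewrite inE => /orP[/eqP ->|kks].
  exact: wedge_sq.
rewrite wedgeC (_ : wedge _ _ s = wedge (block l) (fun=> 0) s).
  by rewrite wedge_cst0 oppr0.
by apply: eq_wedge => t _; apply: IH.
Qed.

(** Each value is a signed sum of products of one weight from every block. The factor x collects the
    weights already extracted, and the element of T provides a choice function when no block is
    left. *)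
Lemma blocks_ideal I x ks s : uniq ks ->
    (forall tau : nat -> T, {in ks, forall k, beta (tau k) = k} ->
      I (x * \prod_(k <- ks) w (tau k))) ->
  T -> I (x * blocks ks s).
Proof.
elim: ks x s => [|k ks IH] x s /= => [_ Itau i0|/andP[kks uks] Itau i0].
  by have := Itau (fun=> i0); rewrite big_nil; apply.
apply: wedge_ideal => i t _; rewrite /block mulrA.
have [bi|_] := eqVneq; last by rewrite mulr0 mul0r; apply: ideal0.
apply: IH => // tau tauP; rewrite -mulrA.
have := Itau (fun l => if l == k then i else tau l).
rewrite big_cons eqxx.
rewrite (eq_big_seq (fun l => w (tau l))) => [|l lks]; last first.
  by case: eqVneq lks kks => // -> ->.
apply=> l; rewrite inE; case: eqVneq => [-> _|_ /=]; first exact: bi.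
exact: tauP.
Qed.

(** No later entry lies in the block of the first one, so only the leading term of each [wedge]
    survives. *)
Lemma blocks_diag (tau : nat -> T) ks :
    uniq ks -> {in ks, forall k, beta (tau k) = k} ->
  blocks ks (map tau ks) = \prod_(k <- ks) w (tau k).
Proof.
elim: ks => [|k ks IH] /=; first by rewrite big_nil.
case/andP=> kks uks tauP; rewrite big_cons wedge0 ?subr0.
  rewrite /block tauP ?mem_head // eqxx IH // => l lks.
  by apply: tauP; rewrite inE lks orbT.
move=> _ /mapP[l lks ->]; rewrite /block tauP ?inE ?lks ?orbT //.
by case: eqVneq lks kks => // -> ->.
Qed.

(* The connecting homomorphism sends the class of c = phi_1 /\ ... /\ phi_d to
   X /\ c = phi_0 /\ ... /\ phi_d, which has values in J but is not the
   coboundary of a cochain with values in J: such coboundaries lie in L. *)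
Lemma not_acyclic J L d (tau0 : nat -> T) :
    (forall i, w i * a (beta i) = X i) -> (forall i, (beta i <= d)%N) ->
    a 0 = 1 -> (forall i j, J j -> L (X i * j)) ->
    (forall tau : nat -> T, {in iota 0 d.+1, forall k, beta (tau k) = k} ->
      J (\prod_(k <- iota 0 d.+1) w (tau k))) ->
    {in iota 0 d.+1, forall k, beta (tau0 k) = k} ->
    ~ L (\prod_(k <- iota 0 d.+1) w (tau0 k)) ->
  ~ acyclic_at J d.
Proof.
move=> wa lebd a0 JL Jprod tau0P nL ac.
pose c := blocks (iota 1 d).
have XcE s : wedge X c s = blocks (iota 0 d.+1) s.
  (* The blocks with k > 0 already occur in c and contribute nothing; [block 0] has coefficient
     1. *)
  transitivity (wedge (fun i => \sum_(k < d.+1) a k * block k i) c s).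
    apply: eq_wedgel => i; have bd : (beta i < d.+1)%N by rewrite ltnS.
    rewrite (bigD1 (Ordinal bd)) //= /block eqxx mulrC wa big1 ?addr0 //.
    move=> k nk.
    case: (eqVneq (beta i) k) nk => [e|_ _]; last by rewrite mulr0.
    by rewrite -val_eqE /= e eqxx.
  rewrite wedge_suml big_ord_recl a0 mul1r big1 ?addr0 // => k _.
  by rewrite wedge_blocks0 ?mulr0 // mem_iota /= add1n ltnS ltn_ord.
have [|b bP] := ac c.
  move=> s _; rewrite XcE -[blocks _ s]mul1r.
  apply: blocks_ideal (tau0 0) => [|tau tauP]; first exact: iota_uniq.
  by rewrite mul1r; apply: Jprod.
apply: nL; rewrite -(blocks_diag (iota_uniq _ _) tau0P) -XcE.
(* Subtracting the coboundary of b does not change X wedge c, but makes the cochain take its values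
   in J. *)
have -> : wedge X c (map tau0 (iota 0 d.+1)) =
    1 * wedge X (fun t => c t - wedge X b t) (map tau0 (iota 0 d.+1)).
  rewrite mul1r -[LHS]addr0 -[X in _ + X]oppr0.
  rewrite -(wedge_sq X b (map tau0 (iota 0 d.+1))).
  rewrite addrC -mulN1r -wedge_lin; apply: eq_wedge => t _.
  by rewrite mulN1r addrC.
apply: wedge_ideal => i t; rewrite size_map size_iota => -[st].
by rewrite mul1r; apply/JL/bP.
Qed.

End NonvanishingClass.
End KoszulCochains.

(** * Depth *)

Lemma ideal_gen_mem (R : comNzRingType) (G : R -> Prop) p :
  G p -> ideal_of (ideal_gen G) p.
Proof.
move=> Gp; apply/ideal_genP; exists [:: (1, p)]; rewrite big_seq1 mul1r.
by split=> // c; rewrite inE => /eqP ->.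
Qed.

Lemma ideal_gen_min (R : comNzRingType) (G : R -> Prop) (I : ideal R) p :
  (forall x, G x -> I x) -> ideal_of (ideal_gen G) p -> I p.
Proof.
move=> GI /ideal_genP[s [Gs ->]]; apply: ideal_sum => c cs.
by apply/imemMl/GI/Gs.
Qed.

Section MonomialIdeals.
Variables (K : fieldType) (N : nat).
Local Notation S := {mpoly K[N]}.

(** The k-th power of the irrelevant ideal, described through supports. *)
Definition lowdeg (k : nat) : ideal S.
Proof.
exists (fun p : S => forall m, m \in msupp p -> (k <= mdeg m)%N).
- by move=> m; rewrite msupp0.
- by move=> p q hp hq m /msuppD_le; rewrite mem_cat => /orP[/hp|/hq].
- move=> r p hp m /msuppM_le/allpairsP[[m1 m2] /= [_ /hp km ->]].
  by rewrite mdegD (leq_trans km) ?leq_addl.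
Defined.

Lemma lowdegM k l p q : lowdeg k p -> lowdeg l q -> lowdeg (k + l) (p * q).
Proof.
move=> hp hq m /msuppM_le/allpairsP[[m1 m2] /= [/hp km /hq lm ->]].
by rewrite mdegD leq_add.
Qed.

Lemma lowdeg_var i : lowdeg 1 'X_i.
Proof. by move=> m; rewrite msuppX inE => /eqP ->; rewrite mdeg1. Qed.

Lemma lowdeg_prod (s : seq 'I_N) k :
  lowdeg k (\prod_(i <- s) 'X_i) <-> (k <= size s)%N.
Proof.
have [m mE ->] : exists2 m, mdeg m = size s & \prod_(i <- s) 'X_i = 'X_[m] :> S.
  elim: s => [|i s [m mE IH]].
    by exists 0%MM; rewrite ?mdeg0 ?big_nil ?mpolyX0.
  by exists (U_(i) + m)%MM; rewrite ?mdegD ?mdeg1 ?mE // big_cons IH mpolyXD.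
rewrite -mE; split=> [|km m']; last by rewrite msuppX inE => /eqP ->.
by apply; rewrite msuppX mem_head.
Qed.

Definition irrelevant : submodClosed S^o :=
  ideal_gen (fun p : S => exists i, p = 'X_i).

Lemma irrelevant_var i : ideal_of irrelevant 'X_i.
Proof. by apply: ideal_gen_mem; exists i. Qed.

Lemma irrelevant_lowdeg p : ideal_of irrelevant p -> lowdeg 1 p.
Proof. by apply: ideal_gen_min => _ [i ->]; apply: lowdeg_var. Qed.

Lemma irrelevant_span p :
  ideal_of irrelevant p -> exists g : 'I_N -> S, p = \sum_i g i * 'X_i.
Proof.
move/ideal_genP => [s [Xs ->]] {p}; elim: s Xs => [|c s IH] Xs.
  by exists (fun=> 0); rewrite big_nil big1 // => i _; rewrite mul0r.
have [|g E] := IH; first by move=> d ds; apply: Xs; rewrite inE ds orbT.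
have [i ci] := Xs c (mem_head c s).
exists (fun j => (if j == i then c.1 else 0) + g j); rewrite big_cons E ci.
under [RHS]eq_bigr do rewrite mulrDl.
rewrite big_split /=; congr (_ + _).
rewrite (bigD1 i) //= eqxx big1 ?addr0 // => j /negPf ->.
by rewrite mul0r.
Qed.

Lemma has_depth_irrelevant (J : submodClosed S^o) (s : seq S) d :
    size s = d -> {in s, forall a, ideal_of irrelevant a} ->
    rseq (ideal_of J) s -> (forall p, ideal_of J p -> lowdeg 1 p) ->
    ~ acyclic_at (fun i : 'I_N => 'X_i) (ideal_of J) d ->
  has_depth (quotmod J) irrelevant d.
Proof.
move=> sd irr_s rs Jlow nac; split.
  exists s; split=> //; first by apply/allP => a /irr_s.
  (* J and s lie in the irrelevant ideal, so 1 witnesses that the quotient is nonzero. *)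
  apply/regular_seqP; split=> //; exists 1 => /(foldl_adj_sub Jlow) low1.
  have /low1/(_ 0%MM) : {in s, forall a, lowdeg 1 a}.
    by move=> a /irr_s; apply: irrelevant_lowdeg.
  by rewrite msupp1 mem_head mdeg0 => /(_ isT).
move=> t /allP irr_t /regular_seqP[rt _]; rewrite leqNgt; apply/negP => ltdt.
apply: nac; apply: (rseq_acyclic rt _ ltdt) => f /irr_t.
exact: irrelevant_span.
Qed.

(** * Square-free monomials in one block of variables, embedded by f *)

Section Squarefree.
Variables (n : nat) (f : 'I_n -> 'I_N).

Definition sqfree_gen q (p : S) : Prop :=
  exists A : {set 'I_n}, #|A| = q /\ p = \prod_(i in A) 'X_(f i).

Local Notation V := ([seq 'X_(f i) | i <- enum 'I_n] : seq S).

Lemma sqfree_gen_lowdeg q p :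
  ideal_of (ideal_gen (sqfree_gen q)) p -> lowdeg q p.
Proof.
apply: ideal_gen_min => _ [A [Aq ->]].
have -> : \prod_(i in A) 'X_(f i) = \prod_(i <- map f (enum A)) 'X_i :> S.
  by rewrite big_map big_enum.
by rewrite lowdeg_prod size_map -cardE Aq.
Qed.

Lemma sqfree_gen_seq (s : seq 'I_N) :
  uniq s -> {in s, forall i, exists j, i = f j} ->
  sqfree_gen (size s) (\prod_(i <- s) 'X_i).
Proof.
move=> us sf; have [t sE] : exists t, s = map f t.
  elim: s sf {us} => [|i s IH] sf; first by exists [::].
  have [|t ->] := IH; first by move=> j js; apply: sf; rewrite inE js orbT.
  by have [j ->] := sf i (mem_head i s); exists (j :: t).
rewrite sE in us *; have ut := map_uniq us.
exists [set i in t]; split; first by rewrite cardsE (card_uniqP ut) size_map.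
by rewrite big_map big_uniq //; apply: eq_bigl => i; rewrite inE.
Qed.

Lemma sqfree_genE q :
  ideal_of (ideal_gen (sqfree_gen q)) = sqfree_ideal V q.
Proof.
apply: ideal_ext => p; split.
  apply: ideal_gen_min => _ [A [<- ->]].
  have enumA : enum A = [seq i <- enum 'I_n | i \in A] by rewrite enumT.
  rewrite cardE -big_enum enumA big_filter.
  elim: (enum 'I_n) => [|i s IH]; first by rewrite big_nil.
  rewrite big_cons /=; case: ifP => _ /=; last exact: sqfree_ideal_cons.
  exact: sqfree_ideal_scale.
(* I is quantified so that the monomials containing the split-off variable can be tested in the
   colon of I by it. *)
have main (s : seq 'I_n) (I : ideal S) r : uniq s ->
    (forall A : {set 'I_n}, {subset A <= s} -> #|A| = r ->
      I (\prod_(i in A) 'X_(f i))) ->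
    forall p, sqfree_ideal [seq 'X_(f i) | i <- s] r p -> I p.
  have case0 (t : seq 'I_n) (J : ideal S) :
      (forall A : {set 'I_n}, {subset A <= t} -> #|A| = 0 ->
      J (\prod_(i in A) 'X_(f i))) -> forall p, J p.
    move=> Jt x; rewrite -[x]mulr1; apply: imemMl.
    have := Jt set0; rewrite big_set0; apply; last by rewrite cards0.
    by move=> i; rewrite inE.
  elim: s r I => [|i s IH] [|r] I us Is x; try by move=> _; exact: case0 Is x.
    by move=> ->; apply: ideal0.
  move: us => /= /andP[is_ us] [a [_ [sa [b sb ->] ->]]]; apply: idealD.
    apply: IH sa => // A As; apply: Is => j /As js.
    by rewrite inE js orbT.
  apply: (IH r (colon I 'X_(f i))) => // A As Ar /=.
  have iA : i \notin A by apply: contra is_ => /As.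
  rewrite -big_setU1 //; apply: Is; last by rewrite cardsU1 iA Ar.
  by move=> j; rewrite !inE => /orP[->|/As ->] //; rewrite orbT.
apply: main; first exact: enum_uniq.
by move=> A _ Aq; apply: ideal_gen_mem; exists A.
Qed.

End Squarefree.

Lemma esym_pol_irrelevant (V : seq S) q :
  {in V, forall v, ideal_of irrelevant v} ->
  ideal_of irrelevant (esym_pol V q.+1).
Proof.
elim: V q => [|z V IH] q irrV; first exact: ideal0.
apply: idealD; last by apply/imemMr/irrV/mem_head.
by apply: IH => v vV; apply: irrV; rewrite inE vV orbT.
Qed.

Lemma down_suffix (a : nat -> S) p q :
  (p <= q)%N -> exists t, down a q = t ++ down a p.
Proof.
elim: q => [|q IH]; first by rewrite leqn0 => /eqP ->; exists [::].
rewrite leq_eqVlt => /orP[/eqP ->|/IH [t /= ->]]; first by exists [::].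
by exists (a q.+1 :: t).
Qed.

Local Notation vars h := ([seq 'X_(h i) | i <- enum 'I__] : seq S).
Local Notation esym_down h := (down (esym_pol (vars h))).

Lemma vars_homog (k : nat) (h : 'I_k -> 'I_N) :
  {in vars h, forall v, v \is 1.-homog}.
Proof. by move=> _ /mapP[i _ ->]; rewrite dhomogX; apply/eqP/mdeg1. Qed.

Lemma vars_pos (k : nat) (h : 'I_k -> 'I_N) :
  {in vars h, forall v, pos_homog v}.
Proof. by move=> v /vars_homog; exists 1%N. Qed.

Lemma esym_down_pos (k : nat) (h : 'I_k -> 'I_N) q :
  {in esym_down h q, forall v, pos_homog v}.
Proof.
by move=> _ /mem_down[l l0 ->]; exists l => //; apply/esym_pol_homog/vars_homog.
Qed.

Lemma vars_irrelevant (k : nat) (h : 'I_k -> 'I_N) :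
  {in vars h, forall v, ideal_of irrelevant v}.
Proof. by move=> _ /mapP[i _ ->]; apply: irrelevant_var. Qed.

Lemma esym_down_irrelevant (k : nat) (h : 'I_k -> 'I_N) q :
  {in esym_down h q, forall v, ideal_of irrelevant v}.
Proof.
by move=> _ /mem_down[[|l] // _ ->]; apply/esym_pol_irrelevant/vars_irrelevant.
Qed.

Lemma in_cat_and (s t : seq S) (P : S -> Prop) : {in s, forall v, P v} ->
  {in t, forall v, P v} -> {in s ++ t, forall v, P v}.
Proof. by move=> Ps Pt v; rewrite mem_cat => /orP[/Ps|/Pt]. Qed.

Lemma rseq_one_block (n m : nat) (f : 'I_n -> 'I_N) (g : 'I_m -> 'I_N) q :
    uniq (map f (enum 'I_n) ++ map g (enum 'I_m)) -> (q < n)%N ->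
  rseq (sqfree_ideal (vars f) q.+1) (vars g ++ esym_down f q).
Proof.
move=> ufg ltqn; rewrite -[sqfree_ideal _ _]ideal_add0 ideal_addC.
apply: rseq_sqfree.
- exact: homog_ideal0.
- exact: vars_pos.
- exact: vars_homog.
- by rewrite size_map size_enum_ord ltnW.
have := @rseq_vars K N (map g (enum 'I_m) ++ map f (enum 'I_n)).
rewrite map_cat -[map _ (map g _)]map_comp -[map _ (map f _)]map_comp; apply.
by rewrite uniq_catC.
Qed.

Lemma rseq_one_blockC (n m : nat) (f : 'I_n -> 'I_N) (g : 'I_m -> 'I_N) q :
    uniq (map f (enum 'I_n) ++ map g (enum 'I_m)) -> (q < n)%N ->
  rseq (sqfree_ideal (vars f) q.+1) (esym_down f q ++ vars g).
Proof.
move=> ufg ltqn; apply: rseq_perm (rseq_one_block ufg ltqn).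
- exact/homog_sqfree/vars_homog.
- by apply: in_cat_and; [exact: vars_pos|exact: esym_down_pos].
- by rewrite perm_catC.
Qed.

(** All of e_1, ..., e_m of the second block can follow the e_k of the first, since I_(m+1) of m
    variables is zero. Permuting puts e_(r+1) last after dropping the higher ones, and e_(q+1) of
    the first block may be added to it because it is zero modulo the ideal. *)
Lemma rseq_block_last (n m : nat) (f : 'I_n -> 'I_N) (g : 'I_m -> 'I_N) q r :
    uniq (map f (enum 'I_n) ++ map g (enum 'I_m)) -> (q < n)%N -> (r < m)%N ->
  rseq (sqfree_ideal (vars f) q.+1) (rcons (esym_down f q ++ esym_down g r)
    (esym_pol (vars f) q.+1 + esym_pol (vars g) r.+1)).
Proof.
move=> ufg ltqn ltrm.
set I := sqfree_ideal _ _.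
have hI : homog_ideal I by exact/homog_sqfree/vars_homog.
have : rseq I (esym_down f q ++ esym_down g m).
  rewrite -[I]ideal_add0 -(sqfree_ideal_gt (V := vars g) (q := m.+1)); last first.
    by rewrite size_map size_enum_ord.
  apply: rseq_sqfree => //.
  - exact: esym_down_pos.
  - exact: vars_homog.
  - by rewrite size_map size_enum_ord.
  exact: rseq_one_blockC.
have [t tE] := down_suffix (esym_pol (vars g)) ltrm => rI.
have : rseq I
    (rcons (esym_down f q ++ esym_down g r) (esym_pol (vars g) r.+1) ++ t).
  apply: rseq_perm rI => //; first by apply: in_cat_and; apply: esym_down_pos.
  rewrite tE -cats1; apply/permP => P; rewrite !count_cat /= addn0.
  by lia.
rewrite -cats1 => /rseq_cat[/rseq_cat[rs rl] _].
rewrite -cats1; apply/rseq_cat; split=> //.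
apply: rseq_cons_congr rl; rewrite opprD addrCA subrr addr0.
exact/idealN/sub_foldl_adj/esym_pol_sqfree.
Qed.

Lemma rseq_two_blocks (n m : nat) (f : 'I_n -> 'I_N) (g : 'I_m -> 'I_N) q r :
    uniq (map f (enum 'I_n) ++ map g (enum 'I_m)) -> (q < n)%N -> (r < m)%N ->
  rseq (ideal_cap (sqfree_ideal (vars f) q.+1) (sqfree_ideal (vars g) r.+1))
    (rcons (esym_down f q ++ esym_down g r)
       (esym_pol (vars f) q.+1 + esym_pol (vars g) r.+1)).
Proof.
move=> ufg ltqn ltrm; apply: rseq_cap.
- exact: rseq_block_last.
- have := @rseq_block_last _ _ g f r q _ ltrm ltqn.
  rewrite uniq_catC => /(_ ufg).
  (* Only the entries before the last are permuted, as the last one is in general not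
     homogeneous. *)
  have pC : perm_eq (esym_down g r ++ esym_down f q)
      (esym_down f q ++ esym_down g r).
    by rewrite perm_catC.
  rewrite addrC -!cats1 => /rseq_cat[rs rl]; apply/rseq_cat.
  rewrite -(foldl_adj_perm _ pC); split=> //; apply: rseq_perm pC rs.
    exact/homog_sqfree/vars_homog.
  by apply: in_cat_and; apply: esym_down_pos.
apply: rseq_sqfree.
- exact/homog_sqfree/vars_homog.
- exact: esym_down_pos.
- exact: vars_homog.
- by rewrite size_map size_enum_ord ltnW.
exact: rseq_one_blockC.
Qed.

(** * Two complementary blocks of variables and the depth formulas *)

Section Split.
Variables (n m : nat) (f : 'I_n -> 'I_N) (g : 'I_m -> 'I_N).
Variable sp : 'I_N -> 'I_n + 'I_m.

(** Symmetric in the two embeddings, so that exchanging the blocks gives a second instance. *)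
Definition is_split := [/\ forall j, sp (f j) = inl j,
    forall j, sp (g j) = inr j
  & forall i, match sp i with inl j => i = f j | inr j => i = g j end].

Lemma split_uniq : is_split -> uniq (map f (enum 'I_n) ++ map g (enum 'I_m)).
Proof.
move=> [fK gK _]; rewrite cat_uniq; apply/and3P; split.
- rewrite map_inj_uniq ?enum_uniq // => j j' /(congr1 sp).
  by rewrite !fK => -[].
- apply/hasPn => _ /mapP[j _ ->]; apply/negP => /mapP[j' _ /(congr1 sp)].
  by rewrite fK gK.
rewrite map_inj_uniq ?enum_uniq // => j j' /(congr1 sp).
by rewrite !gK => -[].
Qed.

Lemma beta_uniq (beta : 'I_N -> nat) (tau : nat -> 'I_N) (ks : seq nat) :
  uniq ks -> {in ks, forall k, beta (tau k) = k} -> uniq (map tau ks).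
Proof.
move=> uks tauP; rewrite map_inj_in_uniq // => k l kks lks e.
by rewrite -(tauP k) // -(tauP l) // e.
Qed.

(** The variables of f form q + 1 blocks, all those from index q on sharing block q, with themselves
    as weights. Each variable of g is a block of its own, of weight 1 and with the variable as
    coefficient. The q + 1 + m blocks give d = q + m, and a product of weights has q + 1 distinct
    variables of f. *)
Lemma not_acyclic_one_block q : is_split -> (q < n)%N ->
  ~ acyclic_at (fun i : 'I_N => 'X_i) (ideal_of (ideal_gen (sqfree_gen f q.+1)))
      (q + m).
Proof.
move=> [fK gK spE] ltqn.
pose j0 : 'I_n := Ordinal (leq_ltn_trans (leq0n q) ltqn).
pose beta i := match sp i with inl j => minn j q | inr j => (q.+1 + j)%N end.
pose w i : S := if sp i is inl _ then 'X_i else 1.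
pose a k : S :=
  if (k <= q)%N then 1 else oapp (fun j => 'X_(g j)) 1 (insub (k - q.+1)%N).
pose tau0 k :=
  if (k <= q)%N then f (insubd j0 k) else oapp g (f j0) (insub (k - q.+1)%N).
have prodE tau : {in iota 0 (q + m).+1, forall k, beta (tau k) = k} ->
    \prod_(k <- iota 0 (q + m).+1) w (tau k) =
    \prod_(i <- map tau (iota 0 q.+1)) 'X_i.
  move=> tauP; rewrite -addSn iotaD big_cat -[RHS]mulr1; congr (_ * _).
    rewrite big_map; apply: eq_big_seq => k; rewrite mem_iota => /andP[_ ltk].
    have := tauP k; rewrite mem_iota /beta /w; case: (sp _) => // j.
    by lia.
  apply: big1_seq => k; rewrite mem_iota => /andP[_ /andP[lek ltk]].
  have := tauP k; rewrite mem_iota /beta /w; case: (sp _) => // j.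
  by have := geq_minr j q; lia.
have tau0P : {in iota 0 (q + m).+1, forall k, beta (tau0 k) = k}.
  move=> k; rewrite mem_iota /beta /tau0 => /andP[_ ltk].
  case: leqP => [lekq|ltqk].
    by rewrite fK val_insubd (leq_ltn_trans lekq ltqn); lia.
  have ltm : (k - q.+1 < m)%N by lia.
  by rewrite (insubT (fun i => i < m)%N ltm) /= gK /= subnKC.
apply: (@not_acyclic _ _ _ beta w a _ (lowdeg q.+2) _ tau0) => //.
- move=> i; have := spE i; rewrite /w /beta /a; case: (sp i) => j iE.
    by rewrite geq_minr mulr1.
  by rewrite leqNgt leq_addr /= addKn valK /= mul1r iE.
- move=> i; rewrite /beta; case: (sp i) => j.
    by have := geq_minr j q; lia.
  by have := ltn_ord j; lia.
- move=> i p Jp; apply: (@lowdegM 1 q.+1); first exact: lowdeg_var.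
  exact: (sqfree_gen_lowdeg Jp).
- move=> tau tauP; rewrite prodE //.
  have tauP' : {in iota 0 q.+1, forall k, beta (tau k) = k}.
    by move=> k; rewrite mem_iota => ltk; apply: tauP; rewrite mem_iota; lia.
  apply: ideal_gen_mem; have := @sqfree_gen_seq _ f (map tau (iota 0 q.+1)).
  rewrite size_map size_iota; apply.
    exact: beta_uniq (iota_uniq _ _) tauP'.
  move=> _ /mapP[k kI ->]; have := spE (tau k); have := tauP' k kI.
  rewrite /beta; case: (sp _) => j; last by move: kI; rewrite mem_iota; lia.
  by move=> _ ->; exists j.
by rewrite prodE // lowdeg_prod size_map size_iota ltnn.
Qed.

(** Here every variable is its own weight: the variables of f form q + 1 blocks and those of g form
    r + 1, whence d + 1 = (q + 1) + (r + 1). *)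
Lemma not_acyclic_two_blocks q r : is_split -> (q < n)%N -> (r < m)%N ->
  ~ acyclic_at (fun i : 'I_N => 'X_i)
      (ideal_of (ideal_mul (ideal_gen (sqfree_gen f q.+1))
         (ideal_gen (sqfree_gen g r.+1)))) (q + r.+1).
Proof.
move=> [fK gK spE] ltqn ltrm.
pose j0 : 'I_n := Ordinal (leq_ltn_trans (leq0n q) ltqn).
pose l0 : 'I_m := Ordinal (leq_ltn_trans (leq0n r) ltrm).
pose beta i :=
  match sp i with inl j => minn j q | inr j => (q.+1 + minn j r)%N end.
pose tau0 k :=
  if (k <= q)%N then f (insubd j0 k) else g (insubd l0 (k - q.+1)%N).
have iotaE : iota 0 (q + r.+1).+1 = iota 0 q.+1 ++ iota q.+1 r.+1.
  by rewrite -addSn iotaD.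
apply: (@not_acyclic _ _ _ beta (fun i => 'X_i) (fun=> 1) _
  (lowdeg (q.+1 + r.+1).+1) _ tau0) => //.
- by move=> i; rewrite mulr1.
- move=> i; rewrite /beta; case: (sp i) => j.
    by have := geq_minr j q; lia.
  by have := geq_minr j r; lia.
- move=> i p Jp; apply: (@lowdegM 1 (q.+1 + r.+1)); first exact: lowdeg_var.
  apply: ideal_gen_min Jp => _ [b [c [bI cI ->]]].
  apply: lowdegM; first exact: (sqfree_gen_lowdeg bI).
  exact: (sqfree_gen_lowdeg cI).
- move=> tau tauP; have tauP' k : k \in iota 0 (q + r.+1).+1 ->
      match sp (tau k) with
      | inl j => minn j q = k
      | inr j => (q.+1 + minn j r)%N = k
      end.
    by move=> /tauP; rewrite /beta; case: (sp _).
  apply: ideal_gen_mem; rewrite iotaE big_cat.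
  have mem1 k : k \in iota 0 q.+1 -> k \in iota 0 (q + r.+1).+1.
    by rewrite iotaE mem_cat => ->.
  have mem2 k : k \in iota q.+1 r.+1 -> k \in iota 0 (q + r.+1).+1.
    by rewrite iotaE mem_cat orbC => ->.
  do 2!eexists; split; last reflexivity.
    apply: ideal_gen_mem.
    have := @sqfree_gen_seq _ f (map tau (iota 0 q.+1)).
    rewrite size_map size_iota big_map; apply.
      by apply: beta_uniq (iota_uniq _ _) _ => k /mem1/tauP; apply.
    move=> _ /mapP[k kI ->]; have := spE (tau k); have := tauP' k (mem1 k kI).
    case: (sp _) => j; last by move: kI; rewrite mem_iota; lia.
    by move=> _ ->; exists j.
  apply: ideal_gen_mem.
  have := @sqfree_gen_seq _ g (map tau (iota q.+1 r.+1)).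
  rewrite size_map size_iota big_map; apply.
    by apply: beta_uniq (iota_uniq _ _) _ => k /mem2/tauP; apply.
  move=> _ /mapP[k kI ->]; have := spE (tau k); have := tauP' k (mem2 k kI).
  case: (sp _) => j; last by move=> _ ->; exists j.
  by move: kI; rewrite mem_iota; have := geq_minr j q; lia.
- move=> k; rewrite mem_iota /beta /tau0 => /andP[_ ltk].
  case: leqP => lekq.
    by rewrite fK val_insubd (leq_ltn_trans lekq ltqn); lia.
  have ltm : (k - q.+1 < m)%N by lia.
  by rewrite gK val_insubd ltm; lia.
have -> : \prod_(k <- iota 0 (q + r.+1).+1) 'X_(tau0 k) =
    \prod_(i <- map tau0 (iota 0 (q + r.+1).+1)) 'X_i :> S by rewrite big_map.
by rewrite lowdeg_prod size_map size_iota; lia.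
Qed.

Lemma depth_one_block q : is_split -> (q < n)%N ->
  has_depth (quotmod (ideal_gen (sqfree_gen f q.+1))) irrelevant (m + q).
Proof.
move=> sp_fg ltqn; apply: (@has_depth_irrelevant _ (vars g ++ esym_down f q)).
- by rewrite size_cat size_map size_enum_ord size_down.
- by apply: in_cat_and; [exact: vars_irrelevant|exact: esym_down_irrelevant].
- by rewrite sqfree_genE; apply: rseq_one_block => //; apply: split_uniq.
- move=> p /sqfree_gen_lowdeg hp k /hp; exact: leq_trans.
by rewrite addnC; apply: not_acyclic_one_block.
Qed.

Lemma depth_two_blocks q r : is_split -> (q < n)%N -> (r < m)%N ->
  has_depth (quotmod (ideal_mul (ideal_gen (sqfree_gen f q.+1))
    (ideal_gen (sqfree_gen g r.+1)))) irrelevant (q + r.+1).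
Proof.
move=> sp_fg ltqn ltrm; have ufg := split_uniq sp_fg.
apply: (@has_depth_irrelevant _ (rcons (esym_down f q ++ esym_down g r)
    (esym_pol (vars f) q.+1 + esym_pol (vars g) r.+1))).
- by rewrite size_rcons size_cat !size_down addnS.
- rewrite -cats1; apply: in_cat_and.
    by apply: in_cat_and; apply: esym_down_irrelevant.
  move=> _ /[!inE] /eqP ->.
  by apply: idealD; apply/esym_pol_irrelevant/vars_irrelevant.
- rewrite (_ : ideal_of _ = ideal_cap (sqfree_ideal (vars f) q.+1)
    (sqfree_ideal (vars g) r.+1)); first exact: rseq_two_blocks.
  rewrite -!sqfree_genE; apply: ideal_ext => p; split.
    apply: ideal_gen_min => _ [b [c [bI cI ->]]].
    by split; [exact: imemMr|exact: imemMl].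
  (* The variables of f are regular modulo the square-free ideal of g, so [sqfree_cap] puts the
     intersection into the product. *)
  case; rewrite sqfree_genE => pF pG.
  apply: (sqfree_cap _ _ _ _ pF pG).
  + by rewrite sqfree_genE; apply/homog_sqfree/vars_homog.
  + exact: vars_homog.
  + have ugf : uniq (map g (enum 'I_m) ++ map f (enum 'I_n)).
      by rewrite uniq_catC.
    by rewrite sqfree_genE; case/rseq_cat: (rseq_one_block ugf ltrm).
  move=> b c; rewrite -sqfree_genE => bF cG; apply: ideal_gen_mem.
  by exists b, c.
- move=> p; apply: ideal_gen_min => _ [b [c [/sqfree_gen_lowdeg bF _ ->]]].
  by apply: imemMr => k /bF; apply: leq_trans.
exact: not_acyclic_two_blocks.
Qed.

End Split.
End MonomialIdeals.

Theorem theorem3p4 (K : fieldType) (n m q r : nat)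
    (hq : (q <= n)%N) (hr : (r <= m)%N) (hqr : ~ (q = 0%N /\ r = 0%N)) :
  [/\ q = 0%N ->
        has_depth (quotmod (Jy K n m r)) (irrelevant_ideal K n m) (n + r - 1),
      r = 0%N ->
        has_depth (quotmod (Ix K n m q)) (irrelevant_ideal K n m) (m + q - 1)
    & (0 < q)%N -> (0 < r)%N ->
        has_depth (quotmod (ideal_mul (Ix K n m q) (Jy K n m r)))
          (irrelevant_ideal K n m) (q + r - 1)].
Proof.
have splitP : is_split (@lshift n m) (@rshift n m) (@split n m).
  split=> [j|j|i]; first exact: (unsplitK (inl j)).
    exact: (unsplitK (inr j)).
  by rewrite -{2 3}(splitK i); case: (split i).
(* With the y in the role of the first block, the one-block formula gives the depth of S/J_r. *)
have splitP' : is_split (@rshift n m) (@lshift n m)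
    (fun i => match split i with inl j => inr j | inr j => inl j end).
  case: splitP => lK rK spE; split=> [j|j|i]; rewrite ?lK ?rK //.
  by have := spE i; case: (split i).
split=> [q0|r0|].
- case: r hr hqr => [|r] hr hqr; first by case: hqr.
  by rewrite addnS subn1; exact: (@depth_one_block K _ _ _ _ _ _ r splitP' hr).
- case: q hq hqr => [|q] hq hqr; first by case: hqr.
  by rewrite addnS subn1; exact: (@depth_one_block K _ _ _ _ _ _ q splitP hq).
case: q hq hqr => // q hq _; case: r hr => // r hr _ _.
by rewrite addSn subn1; exact: (@depth_two_blocks K _ _ _ _ _ _ q r splitP hq hr).
Qed.
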